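(* Let $\varepsilon > 0$ be real, let $q$ be a prime power, and let $n, k, m$ be integers with $2 \leq k < n$ and $m \leq q^k$. If $m \geq 2^{n+7-k}\, q\, \varepsilon^{-2}$, then $$K(q,n,k,m) \geq (1-\varepsilon)\, m\, q^{n-k}.$$
   Context: $\mathbb{F}_q$ is the finite field with $q$ elements. For integers $1 \leq k < n$ and $m \geq 1$, a subset $S \subseteq \mathbb{F}_q^n$ is a $(k,m)$-Furstenberg set if for each $k$-dimensional linear subspace $W$ of $\mathbb{F}_q^n$ there is a translate of $W$ that intersects $S$ in at least $m$ points. For $1 \leq k < n$ and $m \leq q^k$, $K(q,n,k,m)$ denotes the least $t$ such that there exists a $(k,m)$-Furstenberg set in $\mathbb{F}_q^n$ of cardinality $t$. *)

(* Defs.v *)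
From HB Require Import structures.
From mathcomp Require Import all_boot all_order all_algebra.
From mathcomp Require Import boolp reals.

Set Implicit Arguments.
Unset Strict Implicit.
Unset Printing Implicit Defensive.

Import Order.TTheory GRing.Theory Num.Theory.

Local Open Scope ring_scope.

Definition translate (F : finFieldType) (n : nat)
    (v : 'rV[F]_n) (W : {vspace 'rV[F]_n}) : {set 'rV[F]_n} :=
  [set v + w | w in W].

Definition furstenberg (F : finFieldType) (n k m : nat)
    (S : {set 'rV[F]_n}) : Prop :=
  forall W : {vspace 'rV[F]_n}, \dim W = k ->
    exists v : 'rV[F]_n, (m <= #|S :&: translate v W|)%N.

(* For m <= #|F| ^ k the whole space is a (k, m)-Furstenberg set, so the
   minimum ranges over a nonempty family and the value is characterized by
   [furstenbergKP]; the value is junk only when no such set exists. *)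
Definition furstenbergK (F : finFieldType) (n k m : nat) : nat :=
  #|[arg min_(S < [set: 'rV[F]_n] | `[< furstenberg k m S >]) #|S|]|.

Lemma furstenberg_setT (F : finFieldType) (n k m : nat) :
  (m <= #|F| ^ k)%N -> furstenberg k m [set: 'rV[F]_n].
Proof.
move=> hm W dW; exists 0; rewrite setTI /translate card_imset; last exact: addrI.
rewrite -dW in hm; apply: leq_trans hm _.
pose f (c : {ffun 'I_(\dim W) -> F}) : 'rV[F]_n :=
  \sum_(i < \dim W) c i *: (vbasis W)`_i.
have fi : injective f.
  move=> c d e; apply/ffunP=> i.
  have fr : free (vbasis W) := basis_free (vbasisP W).
  by have := congr1 (coord (vbasis W) i) e; rewrite /f !coord_sum_free.
have <- : #|[set f c | c in {ffun 'I_(\dim W) -> F}]| = (#|F| ^ \dim W)%N.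
  by rewrite card_imset // card_ffun card_ord.
apply/subset_leq_card/subsetP=> _ /imsetP[c _ ->].
apply: memv_suml => i _; apply: memvZ; apply: vbasis_mem.
by apply: mem_nth; rewrite size_tuple.
Qed.

Lemma furstenbergKP (F : finFieldType) (n k m : nat) :
  (m <= #|F| ^ k)%N ->
  (exists2 S : {set 'rV[F]_n}, furstenberg k m S & #|S| = furstenbergK F n k m)
  /\ (forall S : {set 'rV[F]_n},
        furstenberg k m S -> (furstenbergK F n k m <= #|S|)%N).
Proof.
move=> hm; rewrite /furstenbergK; case: arg_minnP => [|S /asboolP hS minS].
  by apply/asboolP; exact: furstenberg_setT.
by split=> [|S' hS']; [exists S | apply: minS; apply/asboolP].
Qed.

(* Main.v *)
Require Import Defs.
From HB Require Import structures.
From mathcomp Require Import all_boot all_order all_algebra.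
From mathcomp Require Import boolp reals.
From mathcomp Require Import zify ring finfield mpoly.

Set Implicit Arguments.
Unset Strict Implicit.
Unset Printing Implicit Defensive.

Import Order.TTheory GRing.Theory Num.Theory.

Local Open Scope ring_scope.

(** Let N = n - k, and suppose that a (k, m)-Furstenberg set S in F^n has fewer
    than (1 - eps) m q^N points. Project F^n to F^N x F by a uniformly random
    linear map w = (A, a) and call a point of the target rich when its fibre
    contains at least (1 - eps/2) m/q points of S.

    Few points are rich. The mean size of a fibre is |S| / q^(N+1), at most
    (1 - eps) m/q, and distinct points of S collide with probability
    1 / q^(N+1), so that the fibre sizes have variance at most their mean;
    Chebyshev's inequality then bounds the expected number of rich points
    ([sum_card_rich]).

    Yet the rich points almost form a Kakeya set. For a direction v in F^N, the
    map psi = A - a v has rank at most N, so its kernel has dimension at least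
    k, and the Furstenberg property provides a fibre {x psi = y} containing m
    points of S ([furstenberg_fiber]). The projection w sends this fibre into
    the line {(y + t v, t)}. Since a is independent of psi, the second moment
    argument applies again, this time to m points of that fibre distributed
    over q values t: all but a small expected number of points of the line are
    rich ([sum_card_missing]). Adding these missing points for all v gives a
    set which contains a line in each direction (v, 1), and such a set has at
    least q^(N+1) / 2^(N+2) points ([kakeya_lower_bound]). Comparing
    expectations gives eps^2 m <= 2^(N+5) q ([kakeya_comparison]), which the
    hypothesis on m excludes.

    The Kakeya bound is proved by the method of multiplicities. If E is small,
    linear algebra provides a nonzero polynomial P of degree less than i q, in
    N variables z_1, ..., z_N and the variable t, that vanishes to order 2i - 1
    on E. Restricted to a line in direction (v, 1), the Hasse derivatives of P
    of order j < i in the z variables have degree less than i q - j and vanish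
    to order 2i - 1 - j >= i at q points, so they are zero; reading off their
    leading coefficients, the top homogeneous part of P, evaluated at t = 1,
    vanishes to order i at v. A polynomial of degree less than i q which
    vanishes to order i on all of F^N is zero ([mult_vanish]), a
    contradiction. *)

(** * Translation of multivariate polynomials *)

(** The polynomial p(X + b). Its coefficient at m is the Hasse derivative of p
    of multi-index m, evaluated at b; so p vanishes to order i at b when the
    coefficients of [mshift b p] of degree less than i are zero. *)
Definition mshift (A : comNzRingType) N (b : 'I_N -> A) :
    {mpoly A[N]} -> {mpoly A[N]} :=
  mmap (@mpolyC N A) (fun i => 'X_i + (b i)%:MP).

HB.instance Definition _ (A : comNzRingType) N (b : 'I_N -> A) :=
  GRing.RMorphism.copy (mshift b) (mmap (@mpolyC N A) (fun i => 'X_i + (b i)%:MP)).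

Section Shift.
Variables (A : comNzRingType) (N : nat).
Implicit Types (b c : 'I_N -> A) (p : {mpoly A[N]}).

Lemma mshiftC b (a : A) : mshift b a%:MP = a%:MP.
Proof. exact: mmapC. Qed.

Lemma mshiftXU b i : mshift b 'X_i = 'X_i + (b i)%:MP.
Proof. by rewrite /mshift mmapX mmap1U. Qed.

Lemma mshiftZ b (a : A) p : mshift b (a *: p) = a *: mshift b p.
Proof. by rewrite -!mul_mpolyC rmorphM /= mshiftC. Qed.

(** Ring morphisms on polynomials are determined by their values on constants
    and variables. *)
Lemma mpoly_rmorph_eq (S : nzRingType) (f g : {rmorphism {mpoly A[N]} -> S}) :
    (forall a : A, f a%:MP = g a%:MP) -> (forall i, f 'X_i = g 'X_i) ->
  f =1 g.
Proof.
move=> fgC fgX; elim/mpolyind=> [|a m p _ _ IHp]; first by rewrite !rmorph0.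
rewrite !rmorphD IHp -!mul_mpolyC !rmorphM fgC; congr (_ * _ + _).
rewrite mpolyXE_id !rmorph_prod; apply: eq_bigr => i _.
by rewrite !rmorphXn fgX.
Qed.

Lemma eq_mshift b c : b =1 c -> mshift b =1 mshift c.
Proof.
by move=> bc; apply: mpoly_rmorph_eq => *; rewrite /= ?mshiftC ?mshiftXU ?bc.
Qed.

Lemma mshift_comp b c p : mshift b (mshift c p) = mshift (fun i => b i + c i) p.
Proof.
apply: (@mpoly_rmorph_eq _ (mshift b \o mshift c)) => [a|i] /=.
  by rewrite !mshiftC.
by rewrite !mshiftXU rmorphD /= mshiftC mshiftXU mpolyCD addrA.
Qed.

End Shift.

(** * Separating the last variable *)

(** The exponents of all variables but the last. *)
Definition mnmsplit N (m : 'X_{1..N.+1}) : 'X_{1..N} :=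
  [multinom m (widen_ord (leqnSn N) i) | i < N].

(** The exponent that extends m by j on the last variable. *)
Definition mnmjoin N (m : 'X_{1..N}) (j : nat) : 'X_{1..N.+1} :=
  [multinom if unlift ord_max i is Some i' then m i' else j | i < N.+1].

Lemma widen_lift N (i : 'I_N) : widen_ord (leqnSn N) i = lift ord_max i.
Proof. by apply/val_inj; rewrite /= /bump leqNgt ltn_ord. Qed.

Lemma mnmjoinK N (m : 'X_{1..N.+1}) m' j :
  (m == mnmjoin m' j) = (mnmsplit m == m') && (m ord_max == j).
Proof.
apply/eqP/andP => [->|[/eqP<- /eqP<-]].
  split; last by rewrite mnmE unlift_none.
  by apply/eqP/mnmP=> i; rewrite !mnmE widen_lift liftK.
apply/mnmP=> i; rewrite mnmE; case: unliftP => [i' ->|->//].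
by rewrite mnmE widen_lift.
Qed.

Lemma mdeg_join N (m : 'X_{1..N}) j : mdeg (mnmjoin m j) = (mdeg m + j)%N.
Proof.
rewrite !mdegE big_ord_recr /= mnmE unlift_none; congr (_ + _)%N.
by apply: eq_bigr => i _; rewrite mnmE widen_lift liftK.
Qed.

Lemma muniXE N (A : nzRingType) (m : 'X_{1..N.+1}) :
  muni ('X_[m] : {mpoly A[N.+1]}) = 'X_[mnmsplit m] *: 'X^(m ord_max).
Proof. by rewrite muniE msuppX big_seq1 mcoeffX eqxx scale1r. Qed.

Lemma mcoeff_muni N (A : nzRingType) (p : {mpoly A[N.+1]}) j m :
  ((muni p)`_j)@_m = p@_(mnmjoin m j).
Proof.
elim/mpolyind: p => [|a m' p _ _ IHp]; 
  first by rewrite muni0 coef0 [LHS]mcoeff0 [RHS]mcoeff0.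
rewrite muniD coefD [LHS]mcoeffD [RHS]mcoeffD; congr (_ + _); last exact: IHp.
rewrite muniZ muniXE coefZ coefZ coefXn mcoeffCM [RHS]mcoeffZ mcoeffX mnmjoinK.
congr (_ * _); rewrite [X in _ && X]eq_sym; case: (j == _) => /=.
- by rewrite mulr1 mcoeffX andbT.
- by rewrite mulr0 mcoeff0 andbF.
Qed.

(** With the last variable separated, a translation acts on the coefficients by
    the translation of the other variables, and on the main variable. *)
Lemma muni_mshift N (A : comNzRingType) (b : 'I_N.+1 -> A) (p : {mpoly A[N.+1]}) :
  muni (mshift b p) =
  map_poly (mshift (fun i => b (lift ord_max i))) (muni p)
    \Po ('X + ((b ord_max)%:MP)%:P).
Proof.
pose b' := fun i => b (lift ord_max i); pose u := 'X + ((b ord_max)%:MP_[N])%:P.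
apply: (@mpoly_rmorph_eq A N.+1 _ (muni (R := A) (n := N) \o mshift b)
  (comp_poly u \o map_poly (mshift b') \o muni (R := A) (n := N))) => [a|i] /=.
  by rewrite mshiftC muniC map_polyC /= mshiftC comp_polyC.
rewrite mshiftXU muniD muniC muniXE.
have -> : mnmsplit U_(i)%MM =
    if unlift ord_max i is Some i' then U_(i')%MM else 0%MM.
  apply/mnmP => k; rewrite !mnmE widen_lift; case: unliftP => [i' ->|->].
    by rewrite mnm1E (inj_eq lift_inj).
  by rewrite mnm0E (negPf (neq_lift ord_max k)).
rewrite mnm1E; case: unliftP => [i' ->|->].
  rewrite eq_sym (negPf (neq_lift ord_max i')) expr0 alg_polyC map_polyC /=.
  by rewrite mshiftXU comp_polyC polyCD.
by rewrite eqxx expr1 mpolyX0 scale1r map_polyX comp_polyX.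
Qed.

(** * Polynomials vanishing to high order on the whole space *)

Lemma prod_XsubMC (F : finFieldType) N :
  \prod_(z <- [seq v%:MP_[N] | v <- enum F]) ('X - z%:P) = 'X^#|F| - 'X
    :> {poly {mpoly F[N]}}.
Proof.
have := congr1 (map_poly (@mpolyC N F)) (finField_genPoly F).
rewrite rmorphB /= map_polyXn map_polyX => ->.
rewrite rmorph_prod big_map big_enum /=; apply: eq_bigr => v _.
by rewrite rmorphB /= map_polyX map_polyC.
Qed.

(** The polynomial X^q - X is invariant under X -> X + w, for w in F. *)
Lemma comp_XqX (F : finFieldType) N (w : F) :
  ('X^#|F| - 'X) \Po ('X + (w%:MP)%:P) = 'X^#|F| - 'X :> {poly {mpoly F[N]}}.
Proof.
rewrite -prod_XsubMC rmorph_prod /= 2!big_map.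
rewrite 2!big_enum /=.
rewrite (reindex_inj (addIr w)) /=; apply: eq_bigr => v _.
by rewrite comp_polyB comp_polyX comp_polyC mpolyCD polyCD; ring.
Qed.

Lemma uniq_roots_MC (F : finFieldType) N :
  uniq_roots [seq v%:MP_[N] | v <- enum F].
Proof.
have := enum_uniq F; elim: (enum F) => [|v s IHs] //= /andP[vs /IHs ->].
rewrite andbT; apply/allP => _ /mapP[w ws ->]; apply/andP; split.
  by apply/eqP; rewrite mulrC.
rewrite -mpolyCB rmorph_unit // unitfE subr_eq0.
by apply: contraNneq vs => <-.
Qed.

(** A polynomial of degree less than i q that vanishes to order i at every point
    of F^N is zero. By induction on N, such a polynomial vanishes
    identically when its last variable is set to any v in F; it is therefore a
    multiple of X^q - X in the last variable. The quotient has degree less than (i - 1) q, and vanishes to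
    order i - 1 everywhere since X^q - X has only simple zeros. *)
Lemma mult_vanish (F : finFieldType) N i (Q : {mpoly F[N]}) :
    (forall m, Q@_m != 0 -> (mdeg m < i * #|F|)%N) ->
    (forall v m, (mdeg m < i)%N -> (mshift v Q)@_m = 0) ->
  Q = 0.
Proof.
elim: N i Q => [|N IHN] i Q degQ multQ.
  case: i degQ multQ => [|i] degQ multQ.
    by apply/mpolyP => m; rewrite mcoeff0; apply/eqP/negPn/negP => /degQ.
  rewrite (nvar0_mpolyC Q) -(mshiftC (fun=> 0)) -nvar0_mpolyC.
  by apply/mpolyP => m; rewrite (nvar0_mnmE m) multQ ?mdeg0 ?mcoeff0.
set q := #|F|; have q1 : (1 < q)%N := finNzRing_gt1 F.
suff H : forall i (G : {poly {mpoly F[N]}}),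
    (forall j m, (G`_j)@_m != 0 -> (mdeg m + j < i * q)%N) ->
    (forall v w j m, (mdeg m + j < i)%N ->
      ((map_poly (mshift v) G \Po ('X + (w%:MP)%:P))`_j)@_m = 0) -> G = 0.
  have muniQ0 : muni Q = 0.
    apply: (H i) => [j m|v w j m dm].
      by rewrite mcoeff_muni => /degQ; rewrite mdeg_join.
    pose b k := if unlift ord_max k is Some k' then v k' else w.
    have -> : w = b ord_max by rewrite /b unlift_none.
    have -> : map_poly (mshift v) (muni Q) =
              map_poly (mshift (fun k => b (lift ord_max k))) (muni Q).
      by apply: eq_map_poly; apply: eq_mshift => k; rewrite /b liftK.
    by rewrite -muni_mshift mcoeff_muni multQ ?mdeg_join.
  apply/mpolyP => m; have mE : m = mnmjoin (mnmsplit m) (m ord_max).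
    by apply/eqP; rewrite mnmjoinK !eqxx.
  by rewrite mE -mcoeff_muni muniQ0 coef0 [LHS]mcoeff0 [RHS]mcoeff0.
move=> {Q degQ multQ} {}i; elim: i => [|i IHi] G degG multG.
  apply/polyP => j; apply/mpolyP => m; rewrite coef0 [RHS]mcoeff0.
  by apply/eqP/negPn/negP => /degG.
have Gv v : G.[v%:MP] = 0.
  apply: (IHN i.+1) => [m|u m dm].
    rewrite horner_coef raddf_sum /= => nz.
    have [j _ nzj] : exists2 j : 'I_(size G), true & (G`_j)@_m != 0.
      apply/exists_inP; apply: contraNT nz; rewrite negb_exists_in => /forall_inP h.
      apply/eqP/big1 => j _; have /negPn/eqP := h j isT.
      by rewrite -rmorphXn mulrC mcoeffCM => ->; rewrite mulr0.
    by apply: leq_ltn_trans (degG _ _ nzj); rewrite leq_addr.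
  have := multG u v 0%N m; rewrite addn0 => /(_ dm) <-; congr (_@__).
  rewrite -horner_coef0 horner_comp hornerD hornerX hornerC add0r.
  by rewrite -[in RHS](mshiftC u) horner_map.
have [|G' GE] := uniq_roots_prod_XsubC _ (uniq_roots_MC F N) (p := G).
  by apply/allP => _ /mapP[v _ ->]; apply/eqP/Gv.
rewrite prod_XsubMC -/q in GE; rewrite GE.
suff -> : G' = 0 by rewrite mul0r.
apply: IHi => [j m|v w].
  (* The coefficient of X^(j+q) in G is G'_j - G'_(j+q-1): if it is zero, then
     the coefficient of G' at j+q-1 is nonzero as well. *)
  have [k] := ubnP (size G' - j); elim: k j => // k IHk j ltk nzj.
  have ltj : (j < size G')%N.
    rewrite ltnNge; apply: contra nzj => lej.
    by rewrite (nth_default _ lej) [X in X == _]mcoeff0.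
  have [nz|z] := boolP ((G`_(j + q))@_m != 0); first by have := degG _ _ nz; lia.
  suff /IHk : (G'`_(j + q.-1))@_m != 0 by lia.
  move: z; rewrite negbK GE mulrBr coefB coefMXn coefMX addnK.
  rewrite ltnNge leq_addl /= addn_eq0 (gtn_eqF (ltnW q1)) andbF.
  have -> : (j + q).-1 = (j + q.-1)%N by lia.
  by rewrite mcoeffB subr_eq0 => /eqP <-.
have := multG v w; set u := 'X + _.
have -> : map_poly (mshift v) G \Po u
        = (map_poly (mshift v) G' \Po u) * ('X^q - 'X).
  rewrite GE rmorphM /= comp_polyM; congr (_ * _).
  by rewrite rmorphB /= map_polyXn map_polyX comp_XqX.
set H := _ \Po _ => multH.
(* The coefficient of X^(j+1) in H * (X^q - X) is H_(j+1-q) - H_j. *)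
elim/ltn_ind => j IHj m ltj.
have := multH j.+1 m; rewrite addnS ltnS => /(_ ltj).
rewrite mulrBr coefB coefMXn coefMX /= mcoeffB.
case: ltnP => [_|leq].
  by rewrite [X in X - _]mcoeff0 sub0r => /eqP; rewrite oppr_eq0 => /eqP.
by rewrite IHj ?sub0r; [move=> /eqP; rewrite oppr_eq0 => /eqP|lia|lia].
Qed.

(** * Total degree and top homogeneous part *)

Lemma coefM_top (A : nzRingType) (a b : {poly A}) i j :
  (size a <= i.+1)%N -> (size b <= j.+1)%N -> (a * b)`_(i + j) = a`_i * b`_j.
Proof.
move=> sa sb; have lti : (i < (i + j).+1)%N by rewrite ltnS leq_addr.
rewrite coefM (bigD1 (Ordinal lti)) //= addKn big1 ?addr0 // => k.
rewrite -val_eqE /= => ki; case: (ltngtP k i) ki => // [ltk|gtk] _.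
  have -> : b`_(i + j - k) = 0 by apply/nth_default/(leq_trans sb); lia.
  by rewrite mulr0.
by rewrite [a`_k]nth_default ?mul0r //; apply: leq_trans gtk.
Qed.

Section Top.
Variables (F : finFieldType) (N : nat).
Implicit Types (p : {mpoly {poly F}[N]}) (Q : {mpoly F[N]}).

(** View p, a polynomial in X_1, ..., X_N over F[t], as a polynomial in N + 1
    variables. [topdeg D p Q] says that p has total degree at most D and that Q
    is its homogeneous part of degree D, evaluated at t = 1. When
    [D < mdeg m], the truncated subtraction forces p@_m = 0. *)
Definition topdeg D p Q : Prop :=
  (forall m, (size p@_m <= D.+1 - mdeg m)%N) /\
  (forall m, Q@_m = if (mdeg m <= D)%N then (p@_m)`_(D - mdeg m) else 0).

Lemma topdeg_gt D p m :
    (forall m, (size p@_m <= D.+1 - mdeg m)%N) -> (D < mdeg m)%N -> p@_m = 0.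
Proof.
move=> sp ltm; apply/eqP; rewrite -size_poly_eq0 -leqn0.
by apply: leq_trans (sp m) _; rewrite leqn0 subn_eq0.
Qed.

Lemma topdegM D D' p p' Q Q' :
  topdeg D p Q -> topdeg D' p' Q' -> topdeg (D + D') (p * p') (Q * Q').
Proof.
move=> [sp tp] [sp' tp']; split=> m.
  rewrite mcoeffM; apply: (leq_trans (size_sum _ _ _)); apply/bigmax_leqP => k /eqP.
  move: (bmnm k.1) (bmnm k.2) => {k} k1 k2 ->; rewrite mdegD.
  have := sp k1; have := sp' k2.
  have [->|nz] := eqVneq (p@_k1) 0; first by rewrite mul0r size_poly0.
  have [->|nz'] := eqVneq (p'@_k2) 0; first by rewrite mulr0 size_poly0.
  have := size_polyMleq p@_k1 p'@_k2.
  rewrite -!size_poly_gt0 in nz nz' => sM s' s.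
  have h (a b c d e : nat) : (0 < b -> 0 < c -> a <= (b + c).-1 ->
    c <= D'.+1 - e -> b <= D.+1 - d -> a <= (D + D').+1 - (d + e))%N by lia.
  exact: (h _ _ _ _ _ nz nz').
rewrite !mcoeffM coef_sum.
transitivity (\sum_(k : 'X_{1..N < (mdeg m).+1, (mdeg m).+1} | m == (k.1 + k.2)%MM)
   if (mdeg m <= D + D')%N then (p@_(k.1) * p'@_(k.2))`_(D + D' - mdeg m) else 0);
  last by case: ifP => // _; rewrite big1.
apply: eq_bigr => k /eqP; move: (bmnm k.1) (bmnm k.2) => {k} k1 k2 ->.
rewrite mdegD tp tp'.
have := sp k1; have := sp' k2.
case: (leqP (mdeg k1) D) => [le1|lt1].
  case: (leqP (mdeg k2) D') => [le2|lt2] s2 s1.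
    rewrite leq_add //.
    have -> : (D + D' - (mdeg k1 + mdeg k2) =
               (D - mdeg k1) + (D' - mdeg k2))%N by lia.
    by rewrite coefM_top // -subSn.
  rewrite (topdeg_gt sp' lt2) mulr0 mulr0 coef0; by case: ifP.
by move=> _ _; rewrite (topdeg_gt sp lt1) mul0r mul0r coef0; case: ifP.
Qed.

Lemma topdeg0 D : topdeg D 0 0.
Proof.
split=> m; rewrite !mcoeff0 ?size_poly0 ?leq0n //.
by rewrite coef0; case: ifP.
Qed.

Lemma topdegD D p p' Q Q' :
  topdeg D p Q -> topdeg D p' Q' -> topdeg D (p + p') (Q + Q').
Proof.
move=> [sp tp] [sp' tp']; split=> m.
  rewrite mcoeffD; apply: leq_trans (size_polyD _ _) _.
  by rewrite geq_max sp sp'.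
by rewrite !mcoeffD coefD tp tp'; case: ifP; rewrite ?addr0.
Qed.

Lemma topdeg_sum D (I : finType) (A : {pred I}) (p_ : I -> _) (Q_ : I -> _) :
    (forall i, i \in A -> topdeg D (p_ i) (Q_ i)) ->
  topdeg D (\sum_(i in A) p_ i) (\sum_(i in A) Q_ i).
Proof.
move=> h; elim/big_ind2: _ => //; first exact: topdeg0.
by move=> *; exact: topdegD.
Qed.

Lemma topdegW D D' p Q : (D < D')%N -> topdeg D p Q -> topdeg D' p 0.
Proof.
move=> ltD [sp tp]; split=> m; first by apply: leq_trans (sp m) _; lia.
rewrite mcoeff0; case: ifP => // lem; rewrite nth_default //.
by apply: leq_trans (sp m) _; lia.
Qed.

Lemma topdegC D (a : {poly F}) : (size a <= D.+1)%N -> topdeg D a%:MP (a`_D)%:MP.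
Proof.
move=> sa; split=> m; rewrite !mcoeffC; case: eqP => [->|_] /=;
  rewrite ?mulr1 ?mulr0 ?size_poly0 ?mdeg0 ?subn0 //.
by rewrite coef0; case: ifP.
Qed.

Lemma topdegXU i : topdeg 1 'X_i 'X_i.
Proof.
split=> m; rewrite !mcoeffX; case: eqP => [<-|_] /=;
  rewrite ?size_poly0 ?mdeg1 ?size_poly1 // ?coef1 //.
by rewrite coef0; case: ifP.
Qed.

Lemma topdegX D p Q k : topdeg D p Q -> topdeg (D * k) (p ^+ k) (Q ^+ k).
Proof.
move=> h; elim: k => [|k IHk]; last by rewrite mulnS !exprS; apply: topdegM.
by rewrite muln0; have := @topdegC 0 1; rewrite size_poly1 coef1 eqxx; apply.
Qed.

(** The translate of X^m by y + t v has total degree at most [mdeg m]; its top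
    homogeneous part at t = 1 is the translate of X^m by v, whatever y. *)
Lemma topdeg_mshiftX (y v : 'I_N -> F) m :
  topdeg (mdeg m) (mshift (fun i => (y i)%:P + v i *: 'X) 'X_[m])
                  (mshift v 'X_[m]).
Proof.
rewrite mpolyXE_id mdegE !rmorph_prod /= mpolyXE_id rmorph_prod /=.
elim/big_rec3: _ => [|i Q p d _ IH].
  by have := @topdegC 0 1; rewrite size_poly1 coef1 eqxx; apply.
apply: topdegM => //; rewrite !rmorphXn /= !mshiftXU -[X in topdeg X]mul1n.
apply: topdegX; apply: topdegD; first exact: topdegXU.
set l := (y i)%:P + _; have <- : l`_1 = v i.
  by rewrite coefD coefC coefZ coefX mulr1 add0r.
apply: topdegC; apply: leq_trans (size_polyD _ _) _.
rewrite geq_max (leq_trans (size_polyC_leq1 _)) //=.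
by apply: leq_trans (size_scale_leq _ _) _; rewrite size_polyX.
Qed.

(** * Order of vanishing *)

(** For tau = t - t0, the polynomial p in X and t vanishes to order M at the
    point (0, t0). *)
Definition vanishes (tau : {poly F}) M p := forall m, tau ^+ (M - mdeg m) %| p@_m.

Lemma vanishesM tau M M' p p' :
  vanishes tau M p -> vanishes tau M' p' -> vanishes tau (M + M') (p * p').
Proof.
move=> hp hp' m; rewrite mcoeffM; elim/big_ind: _ => [|a b|k /eqP].
- exact: dvdp0.
- exact: dvdp_add.
move: (bmnm k.1) (bmnm k.2) => {k} k1 k2 ->.
apply: dvdp_trans (dvdp_mul (hp k1) (hp' k2)); rewrite -exprD.
by apply: dvdp_exp2l; rewrite mdegD; lia.
Qed.

Lemma vanishesD tau M p p' :
  vanishes tau M p -> vanishes tau M p' -> vanishes tau M (p + p').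
Proof. by move=> h h' m; rewrite mcoeffD dvdp_add. Qed.

Lemma vanishesX tau M p k : vanishes tau M p -> vanishes tau (M * k) (p ^+ k).
Proof.
move=> h; elim: k => [|k IHk]; last by rewrite mulnS exprS; apply: vanishesM.
by move=> m; rewrite muln0 sub0n expr0 dvd1p.
Qed.

Lemma vanishesC tau M a : tau ^+ M %| a -> vanishes tau M a%:MP.
Proof.
move=> h m; rewrite mcoeffC; case: eqP => [->|_].
  by rewrite mdeg0 subn0 mulr1.
by rewrite mulr0 dvdp0.
Qed.

Lemma vanishesXU tau i : vanishes tau 1 'X_i.
Proof.
move=> m; rewrite mcoeffX; case: eqP => [<-|_]; last exact: dvdp0.
by rewrite mdeg1 subnn dvd1p.
Qed.

(** Moving the origin of X along a curve through (0, t0) preserves the order of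
    vanishing at that point. *)
Lemma vanishes_mshift tau M p (w : 'I_N -> {poly F}) :
  vanishes tau M p -> vanishes tau M (mshift (fun i => w i * tau) p).
Proof.
move=> hp; rewrite [p]mpolyE rmorph_sum; elim/big_ind: _ => [|a b|m _].
- by move=> m; rewrite mcoeff0 dvdp0.
- exact: vanishesD.
suff h : vanishes tau (mdeg m) (mshift (fun i => w i * tau) 'X_[m]).
  rewrite /= mshiftZ -mul_mpolyC => m'.
  apply: dvdp_trans (vanishesM (vanishesC (hp m)) h m').
  by apply: dvdp_exp2l; lia.
rewrite mpolyXE_id mdegE rmorph_prod; elim/big_rec2: _ => [|i p' d _ IH].
  by move=> m'; rewrite sub0n expr0 dvd1p.
apply: vanishesM => //; rewrite rmorphXn /= mshiftXU -[X in vanishes _ X]mul1n.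
apply: vanishesX; apply: vanishesD; first exact: vanishesXU.
by apply: vanishesC; rewrite expr1 dvdp_mull.
Qed.

End Top.

(** * Nonzero solutions of homogeneous linear systems *)

Lemma solve_homogeneous (F : fieldType) (I J : finType) (A : {set I}) (B : {set J})
    (a : I -> J -> F) : (#|B| < #|A|)%N ->
  exists2 x : I -> F, (exists2 i, i \in A & x i != 0) &
    forall j, j \in B -> \sum_(i in A) x i * a i j = 0.
Proof.
move=> ltBA; pose M := \matrix_(i < #|A|, j < #|B|) a (enum_val i) (enum_val j).
have kerM : kermx M != 0.
  rewrite -mxrank_eq0 mxrank_ker -lt0n subn_gt0.
  exact: leq_ltn_trans (rank_leq_col _) ltBA.
have [i0 nz] : exists i, row i (kermx M) != 0.
  apply/existsP; apply: contraNT kerM; rewrite negb_exists => /forallP h.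
  by apply/eqP/row_matrixP => i; rewrite row0; apply/eqP/negPn/h.
set u := row i0 _ in nz; have uM : u *m M = 0.
  by apply/sub_kermxP/row_sub.
have /rV0Pn[k0 uk0] := nz.
have Ak0 := enum_valP k0.
exists (fun i => u 0 (enum_rank_in Ak0 i)).
  by exists (enum_val k0); rewrite ?enum_valK_in.
move=> j Bj; rewrite big_enum_val /=.
have /rowP/(_ (enum_rank_in Bj j)) := uM; rewrite mxE [RHS]mxE => uMj.
rewrite -[RHS]uMj.
by apply: eq_bigr => k _; rewrite enum_valK_in [M _ _]mxE enum_rankK_in.
Qed.

(** * The Kakeya bound by the method of multiplicities *)

Lemma dvdp_prod_XsubC_exp (F : fieldType) (s : seq F) k (p : {poly F}) :
    uniq s -> (forall t, t \in s -> ('X - t%:P) ^+ k %| p) ->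
  \prod_(t <- s) ('X - t%:P) ^+ k %| p.
Proof.
elim: s => [|t s IHs] /= => [_ _|/andP[ts us] h]; first by rewrite big_nil dvd1p.
rewrite big_cons Gauss_dvdp; last first.
  rewrite big_seq; elim/big_rec: _ => [|u r us' IH]; first exact: coprimep1.
  rewrite coprimepMr IH andbT coprimep_expl // coprimep_expr //.
  by rewrite coprimep_XsubC root_XsubC; apply: contraNneq ts => e; subst.
rewrite h ?mem_head // IHs // => u su; apply: h.
by rewrite inE su orbT.
Qed.

Lemma dvdXn_coef (F : fieldType) k (p : {poly F}) :
  (forall j, (j < k)%N -> p`_j = 0) -> 'X^k %| p.
Proof.
move=> p0; rewrite -[p](poly_take_drop k) dvdp_addl ?dvdp_mull //.
suff -> : take_poly k p = 0 by exact: dvdp0.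
by apply/polyP => j; rewrite coef_take_poly coef0; case: ifP => // /p0.
Qed.

Lemma dvdp_XsubC_exp_comp (F : fieldType) k (t : F) (p : {poly F}) :
  (forall j, (j < k)%N -> (p \Po ('X + t%:P))`_j = 0) -> ('X - t%:P) ^+ k %| p.
Proof.
move=> /dvdXn_coef /(dvdp_comp_poly ('X - t%:P)).
by rewrite rmorphXn /= comp_polyX -comp_polyA comp_polyD comp_polyX
  comp_polyC subrK comp_polyXr.
Qed.

Lemma size_XqX (A : nzRingType) q : (1 < q)%N -> size ('X^q - 'X : {poly A}) = q.+1.
Proof. by move=> q1; rewrite size_polyDl size_polyXn // size_polyN size_polyX. Qed.

Lemma mcoeff_sum (A : nzRingType) n (I : Type) (r : seq I) (P : pred I)
    (p_ : I -> {mpoly A[n]}) m :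
  (\sum_(i <- r | P i) p_ i)@_m = \sum_(i <- r | P i) (p_ i)@_m.
Proof. exact: (raddf_sum (mcoeff m)). Qed.

Lemma comp_poly_sum (A : nzRingType) (I : Type) (r : seq I) (P : pred I)
    (p_ : I -> {poly A}) q :
  (\sum_(i <- r | P i) p_ i) \Po q = \sum_(i <- r | P i) (p_ i \Po q).
Proof. exact: (raddf_sum (comp_poly q)). Qed.

Section Kakeya.
Variables (F : finFieldType) (N : nat).

Section Exponents.
Variable K : nat.
Implicit Type t : N.+1.-tuple 'I_K.+1.

(** A tuple t stands for the exponent of a monomial in N + 1 variables: the entry
    at [ord0] is the exponent of the distinguished variable, and [texp t]
    collects the N others. *)
Definition texp t : 'X_{1..N} := [multinom (tnth t (lift ord0 i) : nat) | i < N].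

(** The total degree. *)
Definition tdeg t : nat := \sum_(i <- t) i.

Lemma tdegE t : tdeg t = (tnth t ord0 + mdeg (texp t))%N.
Proof.
rewrite /tdeg big_tuple big_ord_recl mdegE; congr (_ + _)%N.
by apply: eq_bigr => i _; rewrite mnmE.
Qed.

Lemma texp_inj t t' : tdeg t = tdeg t' -> texp t = texp t' -> t = t'.
Proof.
rewrite !tdegE => + ett'; rewrite ett' => /addIn t0; apply: eq_from_tnth => i.
case: (unliftP ord0 i) => [j ->|->]; apply: val_inj => //=.
by have /mnmP/(_ j) := ett'; rewrite !mnmE.
Qed.

Lemma texp_surj (m : 'X_{1..N}) j : (mdeg m + j <= K)%N ->
  exists2 t, tdeg t = (mdeg m + j)%N & texp t = m /\ tnth t ord0 = j :> nat.
Proof.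
move=> le; have mi i : (m i < K.+1)%N.
  by rewrite ltnS (leq_trans _ le) // mdegE (bigD1 i) //= -addnA leq_addr.
exists (cons_tuple (inord j) (mktuple (fun i => inord (m i)))); rewrite ?tdegE;
set t := cons_tuple _ _;
have tm : texp t = m by apply/mnmP => i; rewrite mnmE tnthS tnth_mktuple inordK.
  by rewrite tm tnth0 inordK ?ltnS ?(leq_trans _ le) ?leq_addl // addnC.
by rewrite tm tnth0 inordK // ltnS (leq_trans _ le) // leq_addl.
Qed.

(** The monomial with exponent t; the distinguished variable is that of the
    coefficient ring. *)
Definition tmono t : {mpoly {poly F}[N]} := 'X^(tnth t ord0) *: 'X_[texp t].

End Exponents.

(** The binomial coefficients count the monomials of degree less than
    (i + 1) q, and the conditions imposed at each point of E for vanishing to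
    order 2 i + 1. *)
Lemma kakeya_binomial (E : {set 'rV[F]_N * F}) i :
    (forall v, exists y, forall t, (y + t *: v, t) \in E) ->
  ('C(N.+1 + (i.+1 * #|F|).-1, N.+1) <= #|E| * 'C(N.+1 + i.*2, N.+1))%N.
Proof.
move=> kakE; set q := #|F|; have q1 : (1 < q)%N := finNzRing_gt1 F.
set D := (_ * q).-1; set K := i.*2.
have DE : D.+1 = (i.+1 * q)%N by rewrite /D prednK ?muln_gt0 ?(ltnW q1).
pose A := [set t : N.+1.-tuple 'I_D.+1 | tdeg t <= D]%N.
pose T := [set s : N.+1.-tuple 'I_K.+1 | tdeg s <= K]%N.
rewrite -(card_partial_ord_partitions _ D) -(card_partial_ord_partitions _ K).
rewrite -/A -/T -cardsX leqNgt; apply/negP => ltBA.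
pose a (t : N.+1.-tuple 'I_D.+1) (c : ('rV[F]_N * F) * N.+1.-tuple 'I_K.+1) : F :=
  ((mshift (fun i => (c.1.1 0 i)%:P) (tmono t))@_(texp c.2)
     \Po ('X + c.1.2%:P))`_(tnth c.2 ord0).
have [x [t0 At0 xt0] xa] := solve_homogeneous a ltBA.
pose P := \sum_(t in A) (x t)%:P *: tmono t.
(* P vanishes to order K.+1 at every point of E. *)
have vanP z t : (z, t) \in E ->
    vanishes ('X - t%:P) K.+1 (mshift (fun i => (z 0 i)%:P) P).
  move=> Ez m; apply: dvdp_XsubC_exp_comp => j ltj.
  have [|s degs [sm sj]] := @texp_surj K m j; first by lia.
  have /xa : ((z, t), s) \in setX E T.
    by rewrite !inE Ez /= degs; lia.
  move=> xazt; rewrite -[RHS]xazt rmorph_sum mcoeff_sum comp_poly_sum coef_sum.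
  apply: eq_bigr => u _; rewrite /a /= sm sj.
  by rewrite mshiftZ mcoeffZ comp_polyM comp_polyC coefCM.
case: (@arg_maxnP _ t0 [pred t | (t \in A) && (x t != 0)] (@tdeg _)).
  by rewrite /= At0.
move=> tM /= /andP[AtM xtM] maxt; pose D' := tdeg tM.
(* D' is the exact degree of P, and Q its top homogeneous part. *)
pose Q := \sum_(t in A) (if tdeg t == D' then x t else 0) *: 'X_[F, texp t].
have lineP v y : topdeg D' (mshift (fun i => (y i)%:P + v i *: 'X) P) (mshift v Q).
  rewrite !rmorph_sum; apply: topdeg_sum => t At.
  have [xt0'|xtn0] := eqVneq (x t) 0.
    rewrite xt0' scale0r if_same scale0r !rmorph0; exact: topdeg0.
  have := maxt t; rewrite /= At xtn0 -/D' => /(_ isT) le.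
  have H : topdeg (tdeg t)
       (mshift (fun i => (y i)%:P + v i *: 'X) ((x t)%:P *: tmono t))
       (mshift v (x t *: 'X_[texp t])).
    rewrite /tmono scalerA !mshiftZ -!mul_mpolyC tdegE.
    apply: topdegM; last exact: topdeg_mshiftX.
    have {2}-> : x t = ((x t)%:P * 'X^(tnth t ord0))`_(tnth t ord0).
      by rewrite coefCM coefXn eqxx mulr1.
    apply: topdegC; rewrite mul_polyC; apply: leq_trans (size_scale_leq _ _) _.
    by rewrite size_polyXn.
  case: eqP => [<- //|/eqP ne]; rewrite scale0r rmorph0.
  by apply: topdegW H; rewrite ltn_neqAle ne le.
have Q0 : Q = 0.
  apply: (@mult_vanish _ _ i.+1) => [m|v m ltm].
    rewrite raddf_sum /= => nz.
    have [t At] : exists2 t, t \in A & texp t == m.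
      apply/exists_inP; apply: contraNT nz; rewrite negb_exists_in => /forall_inP h.
      apply/eqP/big1 => t At; rewrite mcoeffZ mcoeffX.
      by rewrite (negPf (h t At)) mulr0.
    move=> /eqP <-; rewrite -/q -DE ltnS; move: At; rewrite inE tdegE.
    by apply: leq_trans; rewrite leq_addl.
  have [y Ey] := kakE (\row_k v k).
  have [sG tG] := lineP v (y 0); rewrite tG; case: ifP => // _.
  set G := mshift _ P in sG tG *.
  suff -> : G@_m = 0 by rewrite coef0.
  have vanG t : vanishes ('X - t%:P) K.+1 G.
    have := vanishes_mshift (fun i => (v i)%:P) (vanP _ _ (Ey t)).
    rewrite mshift_comp => vanPt k; have := vanPt k; rewrite /G.
    rewrite (@eq_mshift _ _ _ (fun k => (y 0 k)%:P + v k *: 'X)) // => l.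
    by rewrite !mxE polyCD polyCM -mul_polyC; ring.
  have dvd : \prod_(t <- enum F) ('X - t%:P) ^+ (K.+1 - mdeg m) %| G@_m.
    by apply: dvdp_prod_XsubC_exp => [|t _]; [exact: enum_uniq|exact: vanG].
  apply/eqP/negPn/negP => nz; have := dvdp_leq nz dvd.
  rewrite big_enum prodrXl -finField_genPoly -/q => szle.
  have := size_exp ('X^q - 'X : {poly F}) (K.+1 - mdeg m).
  rewrite size_XqX //= => szE.
  have leD' : (D' < i.+1 * q)%N by rewrite -DE ltnS; move: AtM; rewrite inE.
  (* A nonzero coefficient would have degree at least q (K.+1 - mdeg m), which
     is at least i.+1 * q as mdeg m <= i, whereas D' < i.+1 * q. *)
  have : (q * i.+1 <= D')%N.
    apply: (@leq_trans (q * (K.+1 - mdeg m))).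
      by rewrite leq_mul2l /K; apply/orP; right; lia.
    rewrite -szE -subn1 leq_subLR add1n; apply: leq_trans szle _.
    by apply: leq_trans (sG m) _; rewrite leq_subr.
  by rewrite leqNgt mulnC leD'.
(* The coefficient of Q at texp tM is x tM, which is nonzero. *)
have /eqP := congr1 (mcoeff (texp tM)) Q0; rewrite mcoeff_sum [X in _ == X]mcoeff0.
rewrite (bigD1 tM) //= big1 => [|t /andP[_ net]]; last first.
  rewrite mcoeffZ mcoeffX; case: eqP => [eqd|]; last by rewrite mul0r.
  case: eqP => [eqe|]; last by rewrite mulr0.
  by rewrite (texp_inj eqd eqe) eqxx in net.
by rewrite addr0 eqxx mcoeffZ mcoeffX eqxx mulr1 (negPf xtM).
Qed.
End Kakeya.

Lemma expn_sub_bernoulli (a d k : nat) : (k * d <= a)%N ->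
  (a ^ k * (a - k * d) <= (a - d) ^ k * a)%N.
Proof.
elim: k => [|k IHk] lea; first by rewrite !expn0 mul0n subn0.
have {}IHk := IHk (leq_trans (leq_addl _ _) lea).
apply: (@leq_trans ((a - d) * (a ^ k * (a - k * d)))); last first.
  by rewrite expnS -mulnA leq_mul2l IHk orbT.
rewrite mulnCA expnSr -mulnA leq_mul2l; apply/orP; right.
rewrite mulSn in lea *.
have [u ->] : exists u, a = (u + (d + k * d))%N by exists (a - (d + k * d))%N; lia.
have -> : (u + (d + k * d) - k * d = u + d)%N by lia.
have -> : (u + (d + k * d) - d = u + k * d)%N by lia.
by rewrite addnK; nia.
Qed.

Lemma expn_le_double (a d : nat) : (2 * d ^ 2 <= a)%N ->
  (a ^ d <= 2 * (a - d) ^ d)%N.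
Proof.
move=> lea; case: (posnP d) => [->//|d0].
have a0 : (0 < a)%N by apply: leq_trans lea; rewrite muln_gt0 expn_gt0 d0.
rewrite -(leq_pmul2r a0) -mulnA.
have := @expn_sub_bernoulli a d d; rewrite mulnn => /(_ _) le.
apply: leq_trans (_ : 2 * (a ^ d * (a - d ^ 2)) <= _)%N.
  by rewrite mulnCA leq_mul2l; apply/orP; right; lia.
by rewrite leq_mul2l /= le //; lia.
Qed.

Lemma ffact_le_expn n d : (n ^_ d <= n ^ d)%N.
Proof.
rewrite ffact_prod; apply: leq_trans (_ : \prod_(i < d) n <= _)%N.
  by apply: leq_prod => i _; exact: leq_subr.
by rewrite prod_nat_const card_ord.
Qed.

Lemma expn_le_ffact n d : (n.+1 ^ d <= (d + n) ^_ d)%N.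
Proof.
rewrite ffact_prod; apply: leq_trans (_ : \prod_(i < d) n.+1 <= _)%N.
  by rewrite prod_nat_const card_ord.
by apply: leq_prod => i _; have := ltn_ord i; lia.
Qed.

(** A set that contains a line in every direction (v, 1) has at least
    q^(N+1) / 2^(N+2) points. *)
Lemma kakeya_lower_bound (F : finFieldType) N (E : {set 'rV[F]_N * F}) :
    (forall v, exists y, forall t, (y + t *: v, t) \in E) ->
  (#|F| ^ N.+1 <= 2 ^ N.+2 * #|E|)%N.
Proof.
move=> kakE; set d := N.+1; set q := #|F|; have q1 : (1 < q)%N := finNzRing_gt1 F.
(* The bounds of [kakeya_binomial] behave as (i q)^d and (2 i)^d for large i;
   d^2 <= i ensures that this loses a factor at most two. *)
have [i lei i_gt0] : exists2 i, (d ^ 2 <= i)%N & (0 < i)%N by exists (d ^ 2)%N.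
have := kakeya_binomial i kakE; rewrite -/d -/q.
rewrite -(leq_pmul2r (fact_gt0 d)) -mulnA !bin_ffact => le.
have {le} : ((i.+1 * q) ^ d <= #|E| * (d + i.*2) ^ d)%N.
  apply: leq_trans (_ : #|E| * (d + i.*2) ^_ d <= _)%N; last first.
    by rewrite leq_mul2l ffact_le_expn orbT.
  apply: leq_trans le; rewrite -{1}[(_ * q)%N]prednK ?muln_gt0 ?(ltnW q1) //.
  exact: expn_le_ffact.
have : ((d + i.*2) ^ d <= 2 * (i.*2) ^ d)%N.
  rewrite -{2}[(i.*2)%N](addKn d); apply: expn_le_double.
  by rewrite -mul2n (leq_trans _ (leq_addl _ _)) // leq_mul2l lei.
rewrite -[i.*2]mul2n !expnMn => le1 le2.
have {le2} : (i.+1 ^ d * q ^ d <= #|E| * (2 * (2 ^ d * i ^ d)))%N.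
  by apply: leq_trans le2 _; rewrite leq_mul2l le1 orbT.
have le3 : (i ^ d <= i.+1 ^ d)%N by rewrite leq_exp2r.
have i0 : (0 < i ^ d)%N by rewrite expn_gt0 i_gt0.
move=> le2; rewrite -(leq_pmul2l i0).
apply: leq_trans (_ : i.+1 ^ d * q ^ d <= _)%N; first by rewrite leq_mul2r le3 orbT.
by apply: leq_trans le2 _; rewrite expnS; lia.
Qed.

(** * Second moment of random bucket sizes *)

(** A random map h w, for w uniform in Om, distributes the points of S into
    buckets indexed by Y. *)
Section Hash.
Variables (Om T Y : finType) (h : Om -> T -> Y) (S : {set T}).

(** The points of S that h w sends to y. *)
Definition bucket w y := [set x in S | h w x == y].

Lemma sum_bucket w : (\sum_y #|bucket w y| = #|S|)%N.
Proof.
rewrite -sum1_card (partition_big (h w) predT) //=.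
by apply: eq_bigr => y _; rewrite -sum1_card; apply: eq_bigl => x; rewrite inE.
Qed.

Lemma sum_bucket_sqr w :
  (\sum_y #|bucket w y| ^ 2 = \sum_(x in S) \sum_(x' in S) (h w x == h w x'))%N.
Proof.
rewrite (partition_big (h w) predT) //=; apply: eq_bigr => y _.
rewrite (eq_bigr (fun=> #|bucket w y|)) => [|x /andP[_ /eqP->]].
  rewrite sum_nat_const; congr (_ * _)%N.
  by apply: eq_card => x; rewrite !inE.
rewrite -sum1_card big_mkcond [RHS]big_mkcond; apply: eq_bigr => x' _.
by rewrite inE eq_sym; case: (_ \in S); case: eqP.
Qed.

(** Distinct points collide with probability at most 1 / |Y|. *)
Hypothesis hash : forall x x', x != x' ->
  (#|[set w | h w x == h w x']| * #|Y| <= #|Om|)%N.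

Lemma sum_sum_bucket_sqr :
  ((\sum_w \sum_y #|bucket w y| ^ 2) * #|Y| <= #|Om| * #|S| * (#|Y| + #|S|))%N.
Proof.
pose c x x' := #|[set w | h w x == h w x']|.
have -> : ((\sum_w \sum_y #|bucket w y| ^ 2) * #|Y| =
    \sum_(x in S) \sum_(x' in S) c x x' * #|Y|)%N.
  rewrite (eq_bigr _ (fun w _ => sum_bucket_sqr w)) exchange_big /= big_distrl.
  apply: eq_bigr => x _ /=.
  rewrite exchange_big big_distrl; apply: eq_bigr => x' _ /=; congr (_ * _)%N.
  by rewrite /c -sum1dep_card [RHS]big_mkcond; apply: eq_bigr => w _; case: eqP.
rewrite -mulnA mulnCA -sum_nat_const; apply: leq_sum => x Sx.
rewrite (bigD1 x) //= mulnDr leq_add //; first by rewrite leq_mul2r max_card orbT.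
rewrite mulnC -sum_nat_const big_mkcondr; apply: leq_sum => x' _.
by case: ifP => // ne; apply: hash; rewrite eq_sym.
Qed.

Variable R : realFieldType.

Lemma sum_bucket_variance : (0 < #|Y|)%N ->
  \sum_w \sum_y (#|bucket w y|%:R - #|S|%:R / #|Y|%:R) ^+ 2
    <= #|Om|%:R * #|S|%:R :> R.
Proof.
move=> Y0; have Y0' : 0 < #|Y|%:R :> R by rewrite ltr0n.
have var w : \sum_y (#|bucket w y|%:R - #|S|%:R / #|Y|%:R) ^+ 2 =
    (\sum_y #|bucket w y| ^ 2)%N%:R - #|S|%:R ^+ 2 / #|Y|%:R :> R.
  have sb : \sum_y #|bucket w y|%:R = #|S|%:R :> R by rewrite -natr_sum sum_bucket.
  rewrite natr_sum (eq_bigr (fun y => (#|bucket w y| ^ 2)%N%:R +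
      (- (2 * (#|S|%:R / #|Y|%:R)) * #|bucket w y|%:R + (#|S|%:R / #|Y|%:R) ^+ 2))).
    rewrite big_split big_split /= sumr_const -mulr_sumr sb -mulr_natr.
    by congr (_ + _); field; rewrite gt_eqF.
  by move=> y _; rewrite natrX; ring.
rewrite (eq_bigr _ (fun w _ => var w)).
rewrite sumrB sumr_const -natr_sum -[_ *+ #|_|]mulr_natr -(ler_pM2r Y0') mulrBl.
rewrite lerBlDr -[leLHS]natrM; have := sum_sum_bucket_sqr; rewrite -(ler_nat R).
move=> lesq; apply: le_trans lesq _.
rewrite !natrM natrD le_eqVlt; apply/orP; left; apply/eqP.
by field; rewrite gt_eqF.
Qed.

(** Chebyshev's inequality: B is a set of buckets whose size deviates from the
    mean by at least c. *)
Lemma bucket_chebyshev (B : {set Om * Y}) (c : R) : (0 < #|Y|)%N -> 0 <= c ->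
    (forall w y, (w, y) \in B -> c <= `|#|bucket w y|%:R - #|S|%:R / #|Y|%:R|) ->
  #|B|%:R * c ^+ 2 <= #|Om|%:R * #|S|%:R.
Proof.
move=> Y0 c0 devB; apply: le_trans (sum_bucket_variance Y0).
rewrite pair_bigA /= (bigID (mem B)) /= mulrC mulr_natr -sumr_const.
rewrite -[leLHS]addr0 lerD ?sumr_ge0 // => [|? _]; last exact: sqr_ge0.
apply: ler_sum => -[w y] /devB /= dev; rewrite -[leRHS]real_normK ?num_real //.
by rewrite lerXn2r ?nnegrE.
Qed.

End Hash.

(** If each [tr y] is injective and sends P into the fibre of g over y, then P has
    density at most 1 / |Y|. *)
Lemma card_translates (Om Y : finType) (P : {set Om}) (g : Om -> Y)
    (tr : Y -> Om -> Om) :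
    (forall y, injective (tr y)) -> (forall w y, w \in P -> g (tr y w) = y) ->
  (#|P| * #|Y| <= #|Om|)%N.
Proof.
move=> tr_inj gtr; rewrite -cardsT -cardsX.
rewrite -(@card_in_imset _ _ (fun wy : Om * Y => tr wy.2 wy.1)) ?max_card //.
move=> [w y] [w' y'] /setXP[Pw _] /setXP[Pw' _] /= e.
have := congr1 g e; rewrite !gtr // => yy; rewrite yy in e *.
by rewrite (tr_inj _ _ _ e).
Qed.

(** * Random linear projections *)

Section Projection.
Variables (F : finFieldType) (n : nat).

Lemma row_right_inverse (u : 'rV[F]_n) : u != 0 ->
  exists c : 'cV[F]_n, u *m c = 1%:M.
Proof.
move=> /rV0Pn[i ui]; exists ((u 0 i)^-1 *: delta_mx i 0).
rewrite -scalemxAr -colE; apply/matrixP => a b.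
by rewrite !ord1 !mxE /= mulVf.
Qed.

(** The linear map from F^n to F^N x F given by the matrix w.1 and the column
    w.2. *)
Definition proj_pair N (w : 'M[F]_(n, N) * 'cV[F]_n) (x : 'rV[F]_n) :
    'rV[F]_N * F :=
  (x *m w.1, (x *m w.2) 0 0).

Lemma proj_pair_hash N (x x' : 'rV[F]_n) : x != x' ->
  (#|[set w | @proj_pair N w x == proj_pair w x']| * #|{: 'rV[F]_N * F}|
     <= #|{: 'M[F]_(n, N) * 'cV[F]_n}|)%N.
Proof.
rewrite -subr_eq0 => /row_right_inverse[c uc].
apply: (@card_translates _ _ _ (fun w => proj_pair w (x - x'))
  (fun z w => (w.1 + c *m z.1, w.2 + z.2 *: c))).
  by move=> z [w1 w2] [w1' w2'] [/addIr -> /addIr ->].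
move=> [w1 w2] [z t]; rewrite inE => /eqP[e1 e2]; congr (_, _) => /=.
  by rewrite mulmxDr mulmxA uc mul1mx mulmxBl e1 subrr add0r.
rewrite mulmxDr -scalemxAr uc mulmxBl !mxE eqxx mulr1.
by move: e2; rewrite !mxE => ->; rewrite subrr add0r.
Qed.

(** The linear form on F^n with coefficients a. *)
Definition functional (a : 'cV[F]_n) (x : 'rV[F]_n) : F := (x *m a) 0 0.

Lemma functional_hash (x x' : 'rV[F]_n) : x != x' ->
  (#|[set a | functional a x == functional a x']| * #|F| <= #|{: 'cV[F]_n}|)%N.
Proof.
rewrite -subr_eq0 => /row_right_inverse[c uc].
apply: (@card_translates _ _ _ (fun a => functional a (x - x'))
  (fun t a => a + t *: c)) => [t a a' /addIr //|a t].
rewrite inE => /eqP; rewrite /functional mulmxDr -scalemxAr uc mulmxBl !mxE => ->.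
by rewrite subrr add0r eqxx mulr1.
Qed.

Lemma exists_subvspace (U : {vspace 'rV[F]_n}) k : (k <= \dim U)%N ->
  exists2 W : {vspace 'rV[F]_n}, (W <= U)%VS & \dim W = k.
Proof.
move=> lek; exists <<take k (vbasis U)>>%VS.
  by apply/span_subvP => x /mem_take; exact: vbasis_mem.
have : free (take k (vbasis U)).
  apply: (@catl_free _ _ (drop k (vbasis U))).
  by rewrite cat_take_drop (basis_free (vbasisP U)).
by rewrite /free => /eqP ->; rewrite size_takel // size_tuple.
Qed.

(** The kernel of a linear map of rank at most n - k contains a subspace of
    dimension k, so some fibre of the map contains m points of a
    (k, m)-Furstenberg set. *)
Lemma furstenberg_fiber N k m (S : {set 'rV[F]_n}) (psi : 'M[F]_(n, N)) :
  furstenberg k m S -> (k + N <= n)%N ->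
  exists y, (m <= #|[set x in S | x *m psi == y]|)%N.
Proof.
move=> fS lekN; pose f : 'Hom('rV[F]_n, 'rV[F]_N) := linfun (mulmxr psi).
have [|W Wker dimW] := @exists_subvspace (lker f) k.
  have dimn : \dim (fullv : {vspace 'rV[F]_n}) = n by rewrite dimvf /dim /= mul1n.
  rewrite -(leq_add2r N); apply: leq_trans lekN _.
  rewrite -{1}dimn -(limg_ker_dim f fullv) capfv leq_add2l.
  by apply: leq_trans (dimvS (subvf _)) _; rewrite dimvf /dim /= mul1n.
have [v lev] := fS W dimW; exists (v *m psi); apply: leq_trans lev _.
apply/subset_leq_card/subsetP => x /setIP[Sx /imsetP[w Ww xE]].
rewrite inE Sx xE; move/subvP: Wker => /(_ w Ww).
by rewrite memv_ker lfunE /= mulmxDl => /eqP ->; rewrite addr0.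
Qed.

End Projection.

Lemma exists_subset_card (T : finType) (A : {set T}) m : (m <= #|A|)%N ->
  exists2 B : {set T}, B \subset A & #|B| = m.
Proof.
move=> lem; exists [set x in take m (enum A)].
  by apply/subsetP => x; rewrite inE => /mem_take; rewrite mem_enum.
rewrite cardsE (card_uniqP _) ?take_uniq ?enum_uniq //.
by rewrite size_takel // -cardE.
Qed.

Lemma card_bigcup_leq (I T : finType) (P : I -> {set T}) :
  (#|\bigcup_i P i| <= \sum_i #|P i|)%N.
Proof.
elim/big_rec2: _ => [|i s A _ le]; first by rewrite cards0.
by apply: leq_trans (leq_card_setU _ _) _; rewrite leq_add2l.
Qed.

(** * Comparison with the Kakeya bound *)

Section Concentration.
Variables (R : realFieldType) (F : finFieldType) (n N m : nat) (eps : R).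
Variable S : {set 'rV[F]_n}.
Hypothesis eps_gt0 : 0 < eps.
Hypothesis fiberS : forall psi : 'M[F]_(n, N),
  exists y, (m <= #|[set x in S | x *m psi == y]|)%N.
Local Notation q := #|F|.
Hypothesis smallS : #|S|%:R <= (1 - eps) * m%:R * q%:R ^+ N :> R.

Let avg : R := m%:R / q%:R.
Let dev : R := eps / 2 * avg.

Let qR_gt0 : 0 < q%:R :> R.
Proof. by rewrite ltr0n ltnW ?finNzRing_gt1. Qed.

Let dev_ge0 : 0 <= dev.
Proof. by rewrite /dev /avg !mulr_ge0 ?invr_ge0 ?ler0n ?ltW. Qed.

(** The points whose fibre under the projection w contains at least
    (1 - eps/2) m/q points of S. *)
Definition rich w : {set 'rV[F]_N * F} :=
  [set z | (1 - eps / 2) * avg <= #|bucket (@proj_pair F n N) S w z|%:R].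

(** By the bound on the size of S, the mean size of a fibre is at most
    (1 - eps) m/q; the fibre of a rich point exceeds it by at least
    eps/2 m/q. *)
Lemma sum_card_rich :
  (\sum_w #|rich w|)%:R * dev ^+ 2 <=
    #|{: 'M[F]_(n, N) * 'cV[F]_n}|%:R * #|S|%:R :> R.
Proof.
pose B := [set wz : ('M[F]_(n, N) * 'cV[F]_n) * ('rV[F]_N * F) |
  wz.2 \in rich wz.1].
have -> : (\sum_w #|rich w| = #|B|)%N.
  rewrite -sum1_card (eq_bigl (fun wz => wz.2 \in rich wz.1)) => [|wz];
    last by rewrite inE.
  rewrite -(pair_big_dep xpredT (fun w z => z \in rich w) (fun _ _ => 1%N)) /=.
  by apply: eq_bigr => w _; rewrite sum1_card.
apply: (bucket_chebyshev (@proj_pair_hash F n N)) => //.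
  by apply/card_gt0P; exists (0, 0).
move=> w z; rewrite inE /= inE => richz; apply: le_trans _ (ler_norm _).
have cardY : #|{: 'rV[F]_N * F}|%:R = q%:R ^+ N * q%:R :> R.
  by rewrite card_prod card_mx mul1n natrM natrX.
rewrite lerBrDr; apply: le_trans richz; rewrite addrC -lerBrDr.
have qN : 0 < q%:R ^+ N :> R by rewrite exprn_gt0.
rewrite cardY ler_pdivrMr ?mulr_gt0 //; apply: le_trans smallS _.
rewrite le_eqVlt; apply/orP; left; apply/eqP.
by rewrite /dev /avg; field; rewrite gt_eqF.
Qed.

Let yf (psi : 'M[F]_(n, N)) := xchoose (fiberS psi).

(** The parameters t of the points that are not rich on the line in direction
    (v, 1) through (y, 0), where y is a point to which psi = w.1 - w.2 v maps at
    least m points of S. *)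
Definition missing w (v : 'rV[F]_N) : {set F} :=
  [set t | (yf (w.1 - w.2 *m v) + t *: v, t) \notin rich w].

(** Points x of the fibre of psi over y project to (y + t v, t) with t = x w.2,
    and w.2 is independent of psi. *)
Lemma sum_card_missing v :
  (\sum_w #|missing w v|)%:R * dev ^+ 2 <=
    #|{: 'M[F]_(n, N) * 'cV[F]_n}|%:R * m%:R :> R.
Proof.
(* Take psi = w.1 - w.2 v and w.2 as the independent random variables. *)
rewrite (reindex (fun w : 'M[F]_(n, N) * 'cV[F]_n => (w.1 + w.2 *m v, w.2)));
  last first.
  exists (fun w : 'M[F]_(n, N) * 'cV[F]_n => (w.1 - w.2 *m v, w.2))
    => [[w a] _|[w a] _] /=.
    by rewrite addrK.
  by rewrite subrK.
rewrite /= -(pair_bigA _ (fun psi a => #|missing (psi + a *m v, a) v|)) /=.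
rewrite natr_sum mulr_suml card_prod natrM -mulrA mulr_natl -sumr_const.
apply: ler_sum => psi _.
have [S' S'sub S'm] := exists_subset_card (xchooseP (fiberS psi)).
pose B := [set at_ : 'cV[F]_n * F |
  at_.2 \in missing (psi + at_.1 *m v, at_.1) v].
have -> : (\sum_(a : 'cV[F]_n) #|missing (psi + a *m v, a)%R v| = #|B|)%N.
  rewrite -sum1_card (eq_bigl (fun at_ =>
    at_.2 \in missing (psi + at_.1 *m v, at_.1) v)) => [|at_]; last by rewrite inE.
  rewrite -(pair_big_dep xpredT
    (fun (a : 'cV[F]_n) t => t \in missing (psi + a *m v, a) v) (fun _ _ => 1%N)) /=.
  by apply: eq_bigr => a _; rewrite sum1_card.
rewrite -S'm; apply: (bucket_chebyshev (@functional_hash F n)) => //.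
  by apply/card_gt0P; exists 0.
move=> a t; rewrite !inE /= addrK S'm -/avg -ltNge => poor.
rewrite distrC; apply: le_trans _ (ler_norm _).
have : #|bucket (@functional F n) S' a t|%:R <=
   #|bucket (@proj_pair F n N) S (psi + a *m v, a) (yf psi + t *: v, t)|%:R :> R.
  rewrite ler_nat; apply/subset_leq_card/subsetP => x.
  rewrite !inE => /andP[/(subsetP S'sub)]; rewrite inE.
  move=> /andP[-> /eqP xpsi] /eqP xa.
  rewrite /proj_pair /= -/(functional a x) xa mulmxDr xpsi mulmxA.
  by rewrite [x *m a]mx11_scalar -/(functional a x) xa mul_scalar_mx.
move=> /le_lt_trans/(_ poor) lt; rewrite lerBrDr -lerBrDl; apply: ltW.
apply: lt_le_trans lt _; rewrite le_eqVlt; apply/orP; left; apply/eqP.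
by rewrite /dev; ring.
Qed.

(** Average over w of the Kakeya bound for the rich points completed by the
    missing ones. *)
Lemma kakeya_comparison : (0 < m)%N ->
  eps ^+ 2 * m%:R <= 2 ^+ (N + 5) * q%:R.
Proof.
move=> m_gt0.
pose Om := #|{: 'M[F]_(n, N) * 'cV[F]_n}|.
(* K w completes the rich points to a Kakeya set. *)
pose K w := rich w :|: \bigcup_v
  ((fun t => (yf (w.1 - w.2 *m v) + t *: v, t)) @: missing w v).
have kakK w : (q ^ N.+1 <= 2 ^ N.+2 * (#|rich w| + \sum_v #|missing w v|))%N.
  have : (q ^ N.+1 <= 2 ^ N.+2 * #|K w|)%N.
    apply: kakeya_lower_bound => v; exists (yf (w.1 - w.2 *m v)) => t.
    rewrite /K inE; case: (boolP (_ \in rich w)) => //= nrich.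
    apply/bigcupP; exists v => //; apply/imsetP; exists t => //.
    by rewrite inE.
  move=> /leq_trans; apply; rewrite leq_mul2l; apply/orP; right.
  apply: leq_trans (leq_card_setU _ _) _; rewrite leq_add2l.
  apply: leq_trans (card_bigcup_leq _) _; apply: leq_sum => v _.
  exact: leq_imset_card.
have : (Om * q ^ N.+1 <=
    2 ^ N.+2 * (\sum_w #|rich w| + \sum_v \sum_w #|missing w v|))%N.
  rewrite exchange_big -big_split big_distrr /= -sum_nat_const.
  by apply: leq_sum => w _; exact: kakK.
rewrite -(ler_nat R) [leLHS]natrM [leRHS]natrM !natrX natrD.
rewrite [X in _ + X]natr_sum => le1.
have dev2 : 0 <= dev ^+ 2 by rewrite exprn_ge0.
have {le1} := ler_wpM2r dev2 le1.
rewrite -[leLHS]mulrA -[leRHS]mulrA [(_ + _) * _]mulrDl => le1.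
rewrite [X in _ * (_ + X)]mulr_suml in le1.
have le2 : \sum_v (\sum_w #|missing w v|)%:R * dev ^+ 2 <=
    q%:R ^+ N * (Om%:R * m%:R).
  apply: le_trans (ler_sum _ (fun v _ => sum_card_missing v)) _.
  rewrite sumr_const -[leLHS]mulr_natl card_mx mul1n natrX. by [].
have Om0 : 0 < Om%:R :> R by rewrite ltr0n; apply/card_gt0P; exists 0.
have qN : 0 < q%:R ^+ N :> R by rewrite exprn_gt0.
have le3 := sum_card_rich; rewrite -/Om in le3.
have mR : 0 < m%:R :> R by rewrite ltr0n.
have le4 : #|S|%:R <= m%:R * q%:R ^+ N :> R.
  apply: le_trans smallS _; rewrite -mulrA.
  rewrite ler_piMl ?(mulr_ge0 (ltW mR) (ltW qN)) //.
  by rewrite lerBlDr lerDl ltW.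
have {le1} : Om%:R * (q%:R ^+ N.+1 * dev ^+ 2) <=
    2 ^+ N.+2 * (Om%:R * (m%:R * q%:R ^+ N) + q%:R ^+ N * (Om%:R * m%:R)).
  apply: le_trans le1 _; rewrite ler_pM2l ?exprn_gt0 //; apply: lerD => //.
  by apply: le_trans le3 _; rewrite ler_pM2l.
have -> : Om%:R * (q%:R ^+ N.+1 * dev ^+ 2) =
    (Om%:R * m%:R * q%:R ^+ N / 4 / q%:R) * (eps ^+ 2 * m%:R).
  by rewrite /dev /avg exprS; field; rewrite gt_eqF.
have -> : 2 ^+ N.+2 * (Om%:R * (m%:R * q%:R ^+ N) + q%:R ^+ N * (Om%:R * m%:R)) =
   (Om%:R * m%:R * q%:R ^+ N / 4 / q%:R) * (2 ^+ (N + 5) * q%:R) :> R.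
  by rewrite exprD !exprS; field; rewrite gt_eqF.
by rewrite ler_pM2l // !mulr_gt0 ?invr_gt0.
Qed.

End Concentration.

Theorem theorem2 (R : realType) (eps : R) (q : nat) (F : finFieldType)
    (n k m : nat) :
  0 < eps ->
  #|F| = q ->
  (2 <= k)%N -> (k < n)%N -> (m <= q ^ k)%N ->
  2 ^+ (n + 7 - k) * q%:R * eps ^- 2 <= m%:R ->
  (1 - eps) * m%:R * q%:R ^+ (n - k) <= (furstenbergK F n k m)%:R.
Proof.
move=> eps_gt0 <- {q} _ ltkn lem large.
have [[S furS cardS] _] := furstenbergKP n lem; rewrite -cardS.
have [//|/ltW smallS] := leP.
have q_gt0 : 0 < #|F|%:R :> R by rewrite ltr0n ltnW ?finNzRing_gt1.
have eps2 : 0 < eps ^+ 2 by rewrite exprn_gt0.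
move: large; rewrite ler_pdivrMr // => large.
have large_gt0 : 0 < 2 ^+ (n + 7 - k) * #|F|%:R :> R by rewrite mulr_gt0 ?exprn_gt0.
have m_gt0 : (0 < m)%N.
  rewrite -(ltr0n R) -(pmulr_lgt0 _ eps2); exact: lt_le_trans large.
have lekn : (k + (n - k) <= n)%N by rewrite subnKC // ltnW.
have := kakeya_comparison eps_gt0
  (fun psi => furstenberg_fiber psi furS lekn) smallS m_gt0.
rewrite mulrC => /(le_trans large).
rewrite ler_pM2r // leNgt => /negP[]; rewrite ltr_eXn2l ?ltr1n //; lia.
Qed.
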